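(* Let $q$ be a prime power, $m\ge 1$, and let $C$ be an $[n,k]$ cyclic code over $\mathbb{F}_{q^m}$ with $1\le k\le n-1$ and with $n$ and $q$ coprime. Let $C^\perp$ be its dual code. Then $$d(\lambda(C))\le\min\big(\eta_q(C^\perp)-k+1,\ m\big).$$
   Context: An $[n,k]$ linear code over $\mathbb{F}_{q^m}$ is a $k$-dimensional $\mathbb{F}_{q^m}$-subspace $C$ of $\mathbb{F}_{q^m}^n$. It is cyclic with generator polynomial $g(x)$ (monic, dividing $x^n-1$, of degree $n-k$) if, identifying vectors with polynomials of degree $\le n-1$, $C$ is the ideal generated by $g(x)$ in $\mathbb{F}_{q^m}[x]/(x^n-1)$, i.e. $C=\{c(x)g(x) : c(x)\in\mathbb{F}_{q^m}[x],\ \deg c\le k-1\}$. The dual code $C^\perp$ (with respect to the standard bilinear form on $\mathbb{F}_{q^m}^n$) is an $[n,n-k]$ cyclic code with generator polynomial $h(0)^{-1}x^{k}h(x^{-1})$, where $h(x)=(x^n-1)/g(x)$. The rank weight of a vector $c=(c_1,\dots,c_n)\in\mathbb{F}_{q^m}^n$ is the rank over $\mathbb{F}_q$ of the $m\times n$ matrix $\lambda(c)$ whose $i$-th column is the coordinate vector of $c_i$ in a fixed $\mathbb{F}_q$-basis of $\mathbb{F}_{q^m}$. The rank weight of a code $C$ is $d(\lambda(C))=d_1(\lambda(C))=\min_{c\in C,\,c\ne 0}\mathrm{rk}(\lambda(c))$. Definition of $\eta_q(D)$ for a cyclic code $D$ over $\mathbb{F}_{q^m}$ of length $n$ coprime to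 $q$ with generator polynomial $f(x)$: let $m'$ be a multiple of $m$ such that $f(x)$ splits in $\mathbb{F}_{q^{m'}}[x]$; its roots are simple. Partition the roots of $f(x)$ into classes, two roots being in the same class if and only if they have the same minimal polynomial over $\mathbb{F}_q$, and choose one representative $\beta_1,\dots,\beta_s$ in each class. Then $\eta_q(D)=\sum_{j=1}^{s}[\mathbb{F}_q(\beta_j):\mathbb{F}_q]$. *)

(* Defs.v *)
From HB Require Import structures.
From mathcomp Require Import all_boot all_order all_algebra all_field.

Set Implicit Arguments.
Unset Strict Implicit.
Unset Printing Implicit Defensive.

Import Order.TTheory GRing.Theory Num.Theory.

Local Open Scope ring_scope.

(* Words of length n are row vectors; (c_1, ..., c_n) is identified with the
   polynomial c_1 + c_2 X + ... + c_n X^(n-1), which is [rVpoly c]. *)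
Definition generator_poly (L : fieldType) (n : nat)
    (C : {vspace 'rV[L]_n}) (g : {poly L}) : Prop :=
  [/\ g \is monic, g %| 'X^n - 1, size g = (n - \dim C).+1 &
      forall v : 'rV[L]_n,
        v \in C <->
        exists2 c : {poly L}, (size c <= \dim C)%N & rVpoly v = c * g].

Definition cyclic_code (L : fieldType) (n : nat) (C : {vspace 'rV[L]_n}) :=
  exists g : {poly L}, generator_poly C g.

Definition dual_code (L : fieldType) (n : nat) (C : {vspace 'rV[L]_n}) :
    {vspace 'rV[L]_n} :=
  (\bigcap_(i < \dim C) lker (linfun (mulmxr ((vbasis C)`_i)^T)))%VS.

Lemma dual_codeP (L : fieldType) (n : nat) (C : {vspace 'rV[L]_n})
    (v : 'rV[L]_n) :
  reflect (forall c, c \in C -> \sum_(j < n) v 0 j * c 0 j = 0)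
          (v \in dual_code C).
Proof.
have dotE (c : 'rV[L]_n) : (v *m c^T == 0) = (\sum_(j < n) v 0 j * c 0 j == 0).
  have vcE : (v *m c^T) 0 0 = \sum_(j < n) v 0 j * c 0 j.
    by rewrite mxE; apply: eq_bigr => j _; rewrite mxE.
  rewrite -vcE; apply/eqP/eqP => [-> | v0]; first by rewrite mxE.
  by rewrite [LHS]mx11_scalar v0 raddf0.
rewrite /dual_code; apply: (iffP idP) => [vD c cC | vC].
  apply/eqP; rewrite -dotE (coord_vbasis cC) linear_sum mulmx_sumr /=.
  apply/eqP; rewrite big1 // => i _; rewrite linearZ -scalemxAr /=.
  have : v \in lker (linfun (mulmxr ((vbasis C)`_i)^T)).
    by move: vD; rewrite memvE => /subv_bigcapP/(_ i isT); rewrite -memvE.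
  by rewrite memv_ker lfunE /= => /eqP->; rewrite scaler0.
rewrite memvE; apply/subv_bigcapP => i _.
rewrite -memvE memv_ker lfunE /= dotE; apply/eqP/vC.
by apply/vbasis_mem/mem_nth; rewrite size_tuple.
Qed.

Section RankWeight.

Variables (F : finFieldType) (L : fieldExtType F) (m n : nat).

Definition lambda (b : m.-tuple L) (c : 'rV[L]_n) : 'M[F]_(m, n) :=
  \matrix_(i < m, j < n) coord b i (c 0 j).

(* [finvect_type L] is L with its finite type structure. The value is 0 on the
   zero code, which has no nonzero word. *)
Definition min_rank_weight (b : m.-tuple L) (C : {vspace 'rV[L]_n}) : nat :=
  let c0 : 'rV[finvect_type L]_n := vpick C in
  \rank (lambda b
    [arg min_(c < c0 | ((c : 'rV[L]_n) \in C) && ((c : 'rV[L]_n) != 0))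
       \rank (lambda b c)]).

Lemma min_rank_weightP (b : m.-tuple L) (C : {vspace 'rV[L]_n}) :
  C != 0%VS ->
  (exists c : 'rV[L]_n,
     [/\ c \in C, c != 0 & \rank (lambda b c) = min_rank_weight b C]) /\
  (forall c : 'rV[L]_n,
     c \in C -> c != 0 -> (min_rank_weight b C <= \rank (lambda b c))%N).
Proof.
move=> C0; rewrite /min_rank_weight; case: arg_minnP => [|c /andP[cC c0] cmin].
  by rewrite memv_pick vpick0.
by split=> [|c' c'C c'0]; [exists c | apply/cmin/andP].
Qed.

End RankWeight.

Section Eta.

Variables (F : finFieldType) (L : fieldExtType F).

Section Extension.

(* [baseFieldType M] is M viewed as an extension of F, so that the minimal
   polynomials and the dimensions below are taken over F. *)
Variable M : fieldExtType L.

Definition min_poly_base (z : M) : {poly baseFieldType M} :=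
  minPoly (1%AS : {subfield baseFieldType M}) (z : baseFieldType M).

Definition degree_base (z : M) : nat :=
  \dim <<(1%AS : {subfield baseFieldType M}); (z : baseFieldType M)>>%VS.

Definition splits_in (f : {poly L}) : Prop :=
  exists s : seq M, map_poly (in_alg M) f %= \prod_(z <- s) ('X - z%:P).

Definition class_representatives (f : {poly L}) (B : seq M) : Prop :=
  [/\ {in B, forall z, root (map_poly (in_alg M) f) z},
      forall z, root (map_poly (in_alg M) f) z ->
        exists2 y, y \in B & min_poly_base y = min_poly_base z &
      uniq (map min_poly_base B)].

End Extension.

(* [is_eta D e] reads e = eta_q(D): e is the value computed from some choice of
   the splitting field and of the representatives. *)
Definition is_eta (n : nat) (D : {vspace 'rV[L]_n}) (e : nat) : Prop :=
  exists (f : {poly L}) (M : fieldExtType L) (B : seq M),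
    [/\ generator_poly D f, splits_in M f, class_representatives f B &
        e = (\sum_(z <- B) degree_base z)%N].

End Eta.

(* Main.v *)
(* Over F = F_q let p be the product of the minimal polynomials of the
   representatives beta_j: it is monic of degree eta, and f divides p because
   f, a divisor of X^n - 1, has simple roots.  The shifts X^i p, i < n - eta,
   are thus words of the dual code with entries in F, so that every word
   of C satisfies the linear recurrence with characteristic polynomial p.  In
   lambda(c) every column is then an F-linear combination of the first eta
   ones.  As dim C = k, some nonzero c in C has its first k - 1 entries equal
   to 0, which leaves eta - k + 1 columns spanning all the others. *)
Require Import Defs.
From HB Require Import structures.
From mathcomp Require Import all_boot all_order all_algebra all_field.
From mathcomp Require Import zify.

Import Order.TTheory GRing.Theory Num.Theory.
Local Open Scope ring_scope.

(** Truncation to the first [l] entries, which is multiplication by [P], maps [C] into a space of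
    dimension [l], so it has a nonzero kernel on [C]. *)
Lemma vanishing_word (L : fieldType) (n : nat) (C : {vspace 'rV[L]_n})
    (l : nat) :
  (l < \dim C)%N ->
  exists c : 'rV[L]_n,
    [/\ c \in C, c != 0 & forall j : nat, (j < l)%N -> (rVpoly c)`_j = 0].
Proof.
move=> ltlC.
pose P : 'M[L]_(n, l) := \matrix_(i, j) (i == j :> nat)%:R.
pose f := linfun (mulmxr P : 'rV[L]_n -> 'rV[L]_l).
have K0 : (C :&: lker f)%VS != 0%VS.
  have := limg_ker_dim f C; have := dimvS (subvf (f @: C)%VS).
  rewrite dimvf /dim /= mul1n -dimv_eq0 => le_l dimC.
  by apply: contraTneq ltlC => K0; rewrite -leqNgt -dimC K0.
have := memv_pick (C :&: lker f); set c := vpick _.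
rewrite memv_cap memv_ker lfunE /= => /andP[cC /eqP cP].
exists c; split; rewrite ?vpick0 // => j ltjl.
rewrite coef_rVpoly; case: insubP => //= i _ Di.
have := congr1 (fun u : 'rV[L]_l => u 0 (Ordinal ltjl)) cP.
rewrite !mxE (bigD1 i) //= !mxE /= Di eqxx mulr1 big1 ?addr0 // => i' nei.
by rewrite !mxE /= -[j]Di val_eqE (negPf nei) mulr0.
Qed.

(** Strong induction on [j]: since [p] is monic, the recurrence expresses each row from index [e] on
    through the [e] preceding ones. *)
Lemma recurrence_span (F : fieldType) (m n l e : nat) (p : {poly F})
    (r : nat -> 'rV[F]_m) :
  p \is monic -> size p = e.+1 ->
  (forall j, (j < l)%N -> r j = 0) ->
  (forall i, (i + e < n)%N -> \sum_(j < e.+1) p`_j *: r (i + j)%N = 0) ->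
  forall j, (j < n)%N -> (r j <= \matrix_(i < e - l) r (l + i)%N)%MS.
Proof.
move=> mon_p size_p r0 rec; elim/ltn_ind=> j IHj ltjn.
have [ltjl | lelj] := ltnP j l; first by rewrite r0 ?sub0mx.
have [ltje | leej] := ltnP j e.
  have lt_jl : (j - l < e - l)%N by rewrite ltn_sub2r ?(leq_ltn_trans lelj).
  by rewrite (submx_trans _ (row_sub (Ordinal lt_jl) _)) // rowK /= subnKC.
have := rec (j - e)%N; rewrite subnK // => /(_ ltjn).
have pe : p`_e = 1 by move/monicP: mon_p; rewrite /lead_coef size_p.
rewrite big_ord_recr /= pe scale1r subnK // addrC => /eqP.
rewrite addr_eq0 => /eqP->; rewrite eqmx_opp summx_sub // => i _.
have lt_ij : (j - e + i < j)%N by rewrite -{2}(subnK leej) ltn_add2l.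
by rewrite scalemx_sub // IHj // (ltn_trans lt_ij).
Qed.

Lemma dual_code_recurrence (F : fieldType) (L : fieldExtType F) (n : nat)
    (C : {vspace 'rV[L]_n}) (f : {poly L}) (p : {poly F}) (e : nat)
    (c : 'rV[L]_n) (i : nat) :
  generator_poly (dual_code C) f -> f %| map_poly (in_alg L) p ->
  size p = e.+1 -> c \in C -> (i + e < n)%N ->
  \sum_(j < e.+1) p`_j *: (rVpoly c)`_(i + j) = 0.
Proof.
move=> [mon_f _ size_f memD] dvd_fp size_p cC ltn_ie.
pose P := 'X^i * map_poly (in_alg L) p.
have p0 : p != 0 by rewrite -size_poly_eq0 size_p.
have size_P : size P = (i + e).+1.
  by rewrite /P mulrC size_mulXn ?map_poly_eq0 // size_map_poly size_p addnS.
have P0 : P != 0 by rewrite -size_poly_eq0 size_P.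
have PD : poly_rV P \in dual_code C.
  apply/memD; exists (P %/ f); rewrite ?poly_rV_K ?size_P //.
    (* The quotient has size [i + e + 1 - (n - \dim D)] for the dual code [D]; this is at most
       [\dim D] because [i + e < n]. *)
    rewrite size_divp ?monic_neq0 // size_P size_f /=.
    have := dimvS (subvf (dual_code C)); rewrite dimvf /dim /= mul1n => leDn.
    by rewrite leq_subLR subnK.
  by rewrite divpK // dvdp_mull.
have /dual_codeP/(_ c cC) := PD.
under eq_bigr => j _.
  rewrite mxE -[c 0 j]coef_rVpoly_ord; over.
rewrite -(big_mkord xpredT (fun j => P`_j * (rVpoly c)`_j)).
(* [P] has coefficients only in degrees [i] to [i + e], so the sum is cut at both ends of this
   window. *)
rewrite (big_cat_nat _ (n := i)) //=; last first.
  by rewrite ltnW // (leq_ltn_trans _ ltn_ie) ?leq_addr.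
rewrite big_nat big1 ?add0r => [|j /andP[_ ltji]]; last first.
  by rewrite coefXnM ltji mul0r.
rewrite (big_cat_nat _ (n := (i + e).+1)) ?leqW ?leq_addr //=.
rewrite [X in _ + X]big_nat [X in _ + X]big1 ?addr0 => [|j /andP[leij _]];
  last first.
  by rewrite nth_default ?mul0r // size_P.
rewrite -addnS -{1}[i]add0n big_addn addKn big_mkord => PC0.
rewrite -[RHS]PC0; apply: eq_bigr => j _.
by rewrite coefXnM addnC ltnNge leq_addl addnK coef_map /= mulr_algl.
Qed.

(** The subfield [1] of [baseFieldType M] is the image of [F], so the minimal polynomial descends to
    [F]. The map to [M] is factored through [L], where divisibility by the generator is stated. *)
Lemma min_poly_base_pol (F : finFieldType) (L : fieldExtType F)
    (M : fieldExtType L) (z : M) :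
  exists p : {poly F},
    [/\ p \is monic, size p = (degree_base z).+1 &
        min_poly_base z = map_poly (in_alg M) (map_poly (in_alg L) p)].
Proof.
have /polyOver1P[p Dp] :=
  minPolyOver (1%AS : {subfield baseFieldType M}) (z : baseFieldType M).
exists p; split.
- by have := monic_minPoly 1%AS (z : baseFieldType M); rewrite Dp map_monic.
- have := size_minPoly 1%AS (z : baseFieldType M).
  by rewrite Dp size_map_poly adjoin_degreeE dimv1 divn1.
by rewrite /min_poly_base Dp -map_poly_comp.
Qed.

Lemma coprime_card_natf_neq0 (F : finFieldType) (n : nat) :
  coprime n #|F| -> n%:R != 0 :> F.
Proof.
move=> co_nF; have F0 : #|F|%:R = 0 :> F.
  (* Translation by 1 permutes [F], so the sum of all elements is unchanged when [#|F|] is added to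
     it. *)
  apply: (@addrI _ (\sum_(x : F) x)); rewrite addr0.
  rewrite [RHS](reindex_inj (addIr 1)) big_split /=.
  by rewrite sumr_const.
have [p _ chp] := finPcharP F; apply/eqP => n0.
have : (p %| gcdn n #|F|)%N by rewrite dvdn_gcd !(dvdn_pcharf chp) n0 F0 eqxx.
by rewrite (eqP co_nF) dvdn1 gtn_eqF // prime_gt1 // (pcharf_prime chp).
Qed.

Lemma generator_dvd_base_pol (F : finFieldType) (L : fieldExtType F) (n : nat)
    (M : fieldExtType L) (f : {poly L}) (B : seq M) :
  coprime n #|F| -> f %| 'X^n - 1 -> splits_in M f ->
  class_representatives f B ->
  exists p : {poly F},
    [/\ p \is monic, size p = (\sum_(z <- B) degree_base z).+1 &
        f %| map_poly (in_alg L) p].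
Proof.
move=> co_nF dvd_f [s Ds] [_ repB _].
have [p [mon_p size_p rootp]]: exists p : {poly F},
    [/\ p \is monic, size p = (\sum_(z <- B) degree_base z).+1 &
      {in B, forall y, min_poly_base y
                       %| map_poly (in_alg M) (map_poly (in_alg L) p)}].
  elim: B {repB} => [|y B [p [mon_p size_p rootp]]].
    by exists 1; rewrite monic1 size_poly1 big_nil.
  have [py [mon_py size_py Dpy]] := min_poly_base_pol _ _ _ y.
  exists (py * p); rewrite monicMl // size_monicM ?monic_neq0 //.
  rewrite size_p size_py big_cons addnS; split=> // z.
  rewrite inE !rmorphM /= -Dpy => /predU1P[->|Bz]; first exact: dvdp_mulr.
  by rewrite dvdp_mull ?rootp.
(* Divisibility may be tested over [M], where [f] is a product of linear factors up to a unit. Once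
   these are distinct, it suffices that each root of [f] is a root of [p]. *)
exists p; split=> //; rewrite -(dvdp_map (in_alg M)) (eqp_dvdl _ Ds).
have sep_s: separable_poly (\prod_(z <- s) ('X - z%:P)).
  rewrite -(eqp_separable Ds) separable_map (dvdp_separable dvd_f) //.
  apply: cyclotomic.separable_Xn_sub_1.
  by rewrite -(rmorph_nat (in_alg L)) fmorph_eq0 coprime_card_natf_neq0.
rewrite uniq_roots_dvdp ?uniq_rootsE -?separable_prod_XsubC //.
apply/allP=> z sz.
have /repB[y By Dz]: root (map_poly (in_alg M) f) z.
  by rewrite (eqp_root Ds) root_prod_XsubC.
have rz : root (min_poly_base z : {poly M}) z.
  exact: (root_minPoly 1%AS (z : baseFieldType M)).
by apply: root_dvdp rz; rewrite -Dz rootp.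
Qed.

(** A word of [C] with [\dim C - 1] leading zeros already has rank at most [e - (\dim C - 1)]. *)
Lemma min_rank_weight_le_recurrence (F : finFieldType) (L : fieldExtType F)
    (m n e : nat) (b : m.-tuple L) (C : {vspace 'rV[L]_n}) (p : {poly F}) :
  basis_of {:L} b -> C != 0%VS -> p \is monic -> size p = e.+1 ->
  (forall (c : 'rV[L]_n) i, c \in C -> (i + e < n)%N ->
     \sum_(j < e.+1) p`_j *: (rVpoly c)`_(i + j) = 0) ->
  (min_rank_weight b C + \dim C <= e.+1)%N.
Proof.
move=> basis_b C0 mon_p size_p rec.
have dimC : (0 < \dim C)%N by rewrite lt0n dimv_eq0.
have [|c [cC c0 cl]] := vanishing_word _ _ C (\dim C).-1.
  by rewrite prednK.
have rank_c : (\rank (lambda b c) <= e - (\dim C).-1)%N.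
  pose r j : 'rV_m := \row_i coord b i (rVpoly c)`_j.
  rewrite -mxrank_tr; pose S := \matrix_(i < e - (\dim C).-1) r ((\dim C).-1 + i)%N.
  apply: leq_trans (rank_leq_row S); apply/mxrankS/row_subP => j.
  have -> : row j (lambda b c)^T = r j.
    by apply/rowP => i; rewrite !mxE coef_rVpoly_ord.
  apply: (recurrence_span _ _ n _ _ p) => // [i lti | i lti].
    by apply/rowP => t; rewrite !mxE cl // linear0.
  (* Coordinates in [b] are [F]-linear and [p] has coefficients in [F], so the recurrence passes
     from [c] to each row of [lambda b c]. *)
  apply/rowP => t; have := congr1 (coord b t) (rec _ _ cC lti).
  rewrite summxE mxE linear0 linear_sum => recb; rewrite -[RHS]recb.
  by apply: eq_bigr => u _; rewrite !mxE linearZ.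
(* The subtraction in [rank_c] is truncated; positivity of the rank shows that it is a true one. *)
have rank_gt0 : (0 < \rank (lambda b c))%N.
  rewrite lt0n mxrank_eq0; apply: contraNneq c0 => lam0.
  apply/eqP/rowP => j; rewrite mxE (coord_basis basis_b (memvf (c 0 j))).
  rewrite big1 // => i _.
  have := congr1 (fun A : 'M_(m, n) => A i j) lam0.
  by rewrite !mxE => ->; rewrite scale0r.
have [_ /(_ c cC c0)] := min_rank_weightP b C0.
lia.
Qed.

Theorem proposition6 (F : finFieldType) (L : fieldExtType F) (q m n k : nat)
    (hq : #|F| = q) (hm : \dim {:L} = m)
    (b : m.-tuple L) (hb : basis_of {:L} b)
    (C : {vspace 'rV[L]_n}) (hC : cyclic_code C) (hk : \dim C = k)
    (hkn : (1 <= k <= n - 1)%N) (hnq : coprime n q)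
    (eta : nat) (heta : is_eta (dual_code C) eta) :
  ((min_rank_weight b C)%:Z <= Num.min (eta%:Z - k%:Z + 1) m%:Z :> int).
Proof.
have C0 : C != 0%VS by rewrite -dimv_eq0 hk -lt0n; case/andP: hkn.
have [f [M [B [genf splf repB eta_eq]]]] := heta.
have [_ dvd_f _ _] := genf.
rewrite -hq in hnq.
have [p [mon_p size_p dvd_fp]] :=
  generator_dvd_base_pol _ _ _ _ _ _ hnq dvd_f splf repB.
rewrite -eta_eq in size_p.
have := min_rank_weight_le_recurrence _ _ _ _ _ b C p hb C0 mon_p size_p.
rewrite hk => /(_ (fun c i =>
  dual_code_recurrence _ _ _ _ _ _ _ c i genf dvd_fp size_p)) le_e.
(* The bound by [m] holds because [lambda] has [m] rows. *)
have le_m : (min_rank_weight b C <= m)%N by apply: rank_leq_row.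
rewrite le_min lez_nat le_m andbT.
lia.
Qed.
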